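(* Let $d\geq 3$ and $q\geq 6$ be natural numbers. Then there exists a subset $U$ of the vertices of the Hamming graph $H(d,q)$ of size $|U|=3q^{d-1}$ such that $(U,n(U))$ has VC-dimension $2$.
   Context: The Hamming graph $H(d,q)$ has vertex set $\mathbb Z_q^d$, with two vertices adjacent if and only if they differ in exactly one coordinate. For a vertex $x$, $n(x)$ denotes its neighborhood, the set of vertices adjacent to $x$ (so $x\notin n(x)$), and for a set $U$ of vertices $n(U)=\{n(u):u\in U\}$. A set $W\subseteq U$ is shattered by $n(U)$ if for every $S\subseteq W$ there is $u\in U$ with $n(u)\cap W=S$. The VC-dimension of $(U,n(U))$ is the size of the largest $W\subseteq U$ that is shattered by $n(U)$. *)

(* Defs.v *)
From mathcomp Require Import all_boot all_algebra.

Set Implicit Arguments.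
Unset Strict Implicit.
Unset Printing Implicit Defensive.

Section SetSystems.

Variable T : finType.
Implicit Types (U W S A : {set T}) (F : {set {set T}}).

Definition shattered F W : bool :=
  [forall (S : {set T} | S \subset W), exists A in F, A :&: W == S].

(* When F is empty, no set (not even set0) is shattered, and the value is 0. *)
Definition vc_dim U F : nat :=
  \max_(W : {set T} | (W \subset U) && shattered F W) #|W|.

End SetSystems.

Section HammingGraph.

Variables d q : nat.

(* 'Z_q is the ring of integers mod q only for 1 < q. *)
Definition hvertex : finType := {ffun 'I_d -> 'Z_q}.

Definition hadj (x y : hvertex) : bool := #|[set i | x i != y i]| == 1.

Definition nbh (x : hvertex) : {set hvertex} := [set y | hadj x y].

Definition nbhs (U : {set hvertex}) : {set {set hvertex}} :=
  [set nbh u | u in U].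

End HammingGraph.

(* Main.v *)
Require Import Defs.
From mathcomp Require Import all_boot all_algebra.

(**
  Let U meet every line of H(d,q) in exactly 3 points; then |U| = 3 q^(d-1).
  If {w1,w2,w3} is shattered, some u in U is adjacent to all of it.  No two
  of the w's lie on a line through u: a point of U realizing that pair would
  be a fourth point of U on this line.  Hence the w's differ from u in three
  distinct coordinates, and the points realizing the pairs complete u,w1,w2,w3
  to 7 corners of a combinatorial cube.  It remains to find such a U
  containing no 7 corners of a cube.

  For q > 6 take the x with sum x_i in {0,1,3}: as {0,1,3} is a Sidon set
  modulo q, even a square with all 4 corners in U is impossible.

  For q = 6 this fails, since 3 - 0 = q/2 is an involution.  There, write
  x_i = 2 z_i + e_i and let U be given by the parity of
  sum e_i + #{i < j : 0 < z_i <= z_j}.  Flipping e_i changes the parity, so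
  each line is split evenly and two adjacent points of U differ in z.
  With z = 0,1,2 mapped to (0,0), (1,0), (0,1) in F_2^2, the condition
  0 < z_i <= z_j is a bilinear form, so the second difference of the parity in
  the directions i < j is B(v_i,v_j) with v_i, v_j <> 0; it vanishes iff
  v_i = M v_j for a matrix M of order 3.  The three relations v_i = M v_j,
  v_j = M v_k and v_i = M v_k cannot hold together.
*)

Section Hamming.

Set Implicit Arguments.
Unset Strict Implicit.
Unset Printing Implicit Defensive.

Variables d q : nat.
Implicit Types (x y u v : hvertex d q) (U W S : {set hvertex d q}).
Implicit Types (i j k : 'I_d) (t a b c : 'Z_q).

(** * Coordinate updates and adjacency in the Hamming graph *)

Definition upd x i t : hvertex d q := [ffun k => if k == i then t else x k].

Lemma upd_same x i t : upd x i t i = t.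
Proof. by rewrite ffunE eqxx. Qed.

Lemma upd_other x i k t : k != i -> upd x i t k = x k.
Proof. by rewrite ffunE => /negbTE->. Qed.

Lemma upd_id x i : upd x i (x i) = x.
Proof. by apply/ffunP=> k; rewrite ffunE; case: eqP => [->|]. Qed.

Lemma upd_upd x i a b : upd (upd x i a) i b = upd x i b.
Proof. by apply/ffunP=> k; rewrite !ffunE; case: eqP. Qed.

Lemma updC x i j a b : i != j ->
  upd (upd x i a) j b = upd (upd x j b) i a.
Proof.
move=> nij; apply/ffunP=> k; rewrite !ffunE.
by case: (eqVneq k j) => // ->; rewrite eq_sym (negbTE nij).
Qed.

Lemma hadj_sym x y : hadj x y = hadj y x.
Proof.
by rewrite /hadj; congr (_ == _); apply: eq_card => i; rewrite !inE eq_sym.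
Qed.

Lemma hadjP x y :
  reflect (exists i t, t != x i /\ y = upd x i t) (hadj x y).
Proof.
apply: (iffP cards1P) => [[i Ei]|[i [t [nt ->]]]].
  exists i, (y i); have := set11 i; rewrite -Ei inE eq_sym => ->; split=> //.
  apply/ffunP=> k; rewrite ffunE; have [->//|ki] := eqVneq k i.
  move: ki; rewrite -in_set1 -Ei inE negbK.
  by move/eqP.
exists i; apply/setP=> k; rewrite !inE ffunE.
by case: (eqVneq k i) => [->|_]; rewrite ?eqxx // eq_sym.
Qed.

Lemma hadj_coord x y j k :
  hadj x y -> x j != y j -> x k != y k -> j = k.
Proof.
case/hadjP=> i [t [_ ->]].
have coordE l : x l != upd x i t l -> l = i.
  by rewrite ffunE; case: (eqVneq l i) => // _; rewrite eqxx.
by move=> /coordE-> /coordE->.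
Qed.

Lemma hadj_irr x : hadj x x = false.
Proof. by apply/hadjP => -[i [t [nt Ex]]]; rewrite Ex upd_same eqxx in nt. Qed.

(** Writing [v] as a one-coordinate change of either neighbour gives two expressions for it;
    comparing them coordinatewise leaves only the line through [u] or the fourth corner of a
    square. *)
Lemma common_neighbor u v i j a b :
  a != u i -> b != u j -> upd u i a != upd u j b -> v != u ->
  hadj v (upd u i a) -> hadj v (upd u j b) ->
  (i = j /\ exists c, [/\ c != u i, c != a, c != b & v = upd u i c])
  \/ (i != j /\ v = upd (upd u i a) j b).
Proof.
move=> na nb nw nv av bv.
have := bv; rewrite hadj_sym => /hadjP[j' [b' [nb' Ev']]].
have := av; rewrite hadj_sym => /hadjP[i' [a' [na' Ev]]].
have [ij|nij] := eqVneq i j; [left | right].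
  subst j; have nab : a != b by apply: contraNneq nw => ->.
  have vE k : upd (upd u i a) i' a' k = upd (upd u i b) j' b' k.
    by rewrite -Ev -Ev'.
  have Ei' : i' = i.
    apply/eqP; apply/contraT => ni'.
    have := vE i; rewrite upd_other 1?eq_sym // upd_same.
    have [jE|nj'] := eqVneq j' i; last first.
      by rewrite upd_other 1?eq_sym // upd_same => /eqP; rewrite (negbTE nab).
    subst j'; move=> _; have := vE i'; rewrite upd_same upd_upd upd_other //.
    by move=> Ea'; move: na'; rewrite Ea' upd_other // eqxx.
  subst i'; rewrite upd_upd in Ev.
  split=> //; exists a'; split=> //.
  - by apply: contraNneq nv => Ea; rewrite Ev Ea upd_id.
  - by apply: contraTneq av => Ea; rewrite Ev Ea hadj_irr.
  - by apply: contraTneq bv => Ea; rewrite Ev Ea hadj_irr.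
split=> //.
have vE k : upd (upd u i a) i' a' k = upd (upd u j b) j' b' k.
  by rewrite -Ev -Ev'.
(* If [i' = i], then [v] agrees with [u] at [j], so the other change must undo [b], and [v = u]
   follows. *)
have [Ei'|ni'] := eqVneq i' i.
  subst i'; rewrite upd_upd in vE Ev.
  have := vE j; rewrite upd_other 1?eq_sym //.
  have [Ej'|nj'] := eqVneq j' j; last first.
    by rewrite upd_other 1?eq_sym // upd_same => /esym/eqP; rewrite (negbTE nb).
  subst j' => _; rewrite upd_upd in vE.
  have := vE i; rewrite upd_same upd_other // => Ea'.
  by move: nv; rewrite Ev Ea' upd_id eqxx.
have := vE i; rewrite upd_other 1?eq_sym // upd_same.
have [Ej'|nj'] := eqVneq j' i; last first.
  by rewrite upd_other 1?eq_sym // upd_other // => /eqP; rewrite (negbTE na).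
by rewrite Ej' upd_same Ev' Ej' => ->; rewrite updC // eq_sym.
Qed.

Lemma shattered_trace U W S : shattered (nbhs U) W -> S \subset W ->
  exists2 u, u \in U & forall w, w \in W -> hadj u w = (w \in S).
Proof.
move=> /forallP/(_ S)/implyP sh /sh/existsP[A /andP[/imsetP[u uU ->] /eqP ES]].
by exists u => // w wW; rewrite -ES !inE wW andbT.
Qed.

(** * Sets meeting every line in three points *)

Hypothesis q_gt1 : 1 < q.

Lemma card_Zq : #|'Z_q| = q.
Proof. by rewrite card_ord Zp_cast. Qed.

Variable U : {set hvertex d q}.
Hypothesis line3 : forall x i, #|[set t | upd x i t \in U]| = 3.

Lemma card_of_lines : 2 < d -> #|U| = 3 * q ^ (d - 1).
Proof.
move=> d_gt2; have i0 : 'I_d by exists 0; apply: ltn_trans d_gt2.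
have q_gt0 : 0 < q by apply: ltnW.
(* The factor [q] turns [q ^ (d - 1)] into the number of all vertices. *)
apply/eqP; rewrite -(eqn_pmul2r q_gt0) -mulnA -expnSr subn1 prednK; last first.
  by apply: ltn_trans d_gt2.
(* Double count the pairs (x, t) with [upd x i0 t \in U]. *)
pose f (p : hvertex d q * 'Z_q) := (upd p.1 i0 p.2, p.1 i0).
have fK : involutive f by case=> x t; rewrite /f /= upd_upd upd_id upd_same.
have cardH : #|{: hvertex d q}| = q ^ d.
  by rewrite card_ffun card_Zq card_ord.
have -> : #|U| * q = \sum_(p : hvertex d q * 'Z_q) (p.1 \in U).
  rewrite -(pair_bigA _ (fun x (t : 'Z_q) => (x \in U : nat))) /=.
  under eq_bigr do rewrite sum_nat_const card_Zq mulnC.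
  by rewrite -big_distrl /= -sum1_card big_mkcond.
(* [f] swaps [t] with the coordinate at [i0], so the condition on [x] becomes one on its line. *)
rewrite (reindex_inj (inv_inj fK)) /=.
rewrite -(pair_bigA _ (fun x t => (upd x i0 t \in U : nat))) /=.
rewrite (eq_bigr (fun=> 3)) => [|x _]; last first.
  rewrite -(line3 x i0) -sum1_card [RHS]big_mkcond /=.
  by apply: eq_bigr => t _; rewrite inE.
by rewrite sum_nat_const cardH mulnC.
Qed.

Lemma line_neighbor x i : exists2 t, t != x i & upd x i t \in U.
Proof.
have := line3 x i; rewrite (cardsD1 (x i)) => E.
have: 0 < #|[set t | upd x i t \in U] :\ x i|.
  by rewrite lt0n; apply: contra_eq_neq E => ->; case: (_ \in _).
by case/card_gt0P=> t; rewrite !inE => /andP[nt tU]; exists t.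
Qed.

(** Of three points [x], [y], [z] of [U] on a line, the first two are shattered: [z] sees both, each
    of [x], [y] sees only the other, and [w], which leaves the line in two further coordinates, sees
    neither. *)
Lemma vc_dim_ge2 : 2 < d -> 2 <= vc_dim U (nbhs U).
Proof.
move=> d_gt2.
pose i := Ordinal (ltn_trans (ltn_trans (ltn0Sn 0) (ltnSn 1)) d_gt2).
pose j := Ordinal (ltn_trans (ltnSn 1) d_gt2); pose k := Ordinal d_gt2.
pose x0 : hvertex d q := [ffun=> 0%R].
have /card_gt2P[a [b [c [[]]]]] : 2 < #|[set t | upd x0 i t \in U]|.
  by rewrite line3.
rewrite !inE => aU bU cU [nab nbc nca].
set x := upd x0 i a; set y := upd x0 i b; set z := upd x0 i c.
have adj s t : s != t -> hadj (upd x0 i s) (upd x0 i t).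
  move=> nst; apply/hadjP; exists i, t.
  by rewrite upd_same upd_upd eq_sym.
have nxy : x != y.
  by apply/eqP=> E; have := adj _ _ nab; rewrite -/x E hadj_irr.
(* This intermediate point may lie outside [U]; the second change brings [w] into [U]. *)
have [s ns _] := line_neighbor x j.
have [t nt wU] := line_neighbor (upd x j s) k.
set w := upd _ k t in wU.
have far v : (forall l, l != i -> v l = x0 l) -> hadj w v = false.
  move=> vE; apply/negP=> wv.
  have vx l : l != i -> v l = x l by move=> nl; rewrite vE // upd_other.
  have wj : w j != v j by rewrite vx // upd_other // upd_same.
  have wk : w k != v k by rewrite vx // upd_same -(upd_other (i := j) x s).
  by have := hadj_coord wv wj wk.
have wx : hadj w x = false by apply: far => l nl; rewrite upd_other.
have wy : hadj w y = false by apply: far => l nl; rewrite upd_other.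
have <- : #|[set x; y]| = 2 by rewrite cards2 nxy.
apply: (bigmax_sup [set x; y]) => //; apply/andP; split.
  by apply/subsetP=> v; rewrite !inE => /orP[] /eqP->.
apply/forallP=> S; apply/implyP=> /subsetP sS.
suff [u uU [ux uy]] :
    exists2 u, u \in U & hadj u x = (x \in S) /\ hadj u y = (y \in S).
  apply/existsP; exists (nbh u); rewrite imset_f //=; apply/eqP/setP=> v.
  rewrite !inE; have [->|nvx] := eqVneq v x; first by rewrite andbT.
  have [->|nvy] := eqVneq v y; first by rewrite andbT.
  rewrite andbF; apply/esym/negP=> /sS.
  by rewrite !inE (negbTE nvx) (negbTE nvy).
case: (x \in S); case: (y \in S).
- by exists z => //; split; apply: adj => //; rewrite eq_sym.
- by exists y => //; rewrite hadj_irr; split=> //; apply: adj; rewrite eq_sym.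
- by exists x => //; rewrite hadj_irr; split=> //; apply: adj.
- by exists w.
Qed.

(** For [i = j], four points of [U] would share a line, against [line3]. *)
Lemma square_of_common_neighbor u v i j a b :
  u \in U -> v \in U -> a != u i -> b != u j ->
  upd u i a \in U -> upd u j b \in U -> upd u i a != upd u j b -> v != u ->
  hadj v (upd u i a) -> hadj v (upd u j b) ->
  i != j /\ upd (upd u i a) j b \in U.
Proof.
move=> uU vU na nb aU bU nab nv va vb.
have [[ij [c [cu ca cb vE]]]|[nij vE]] := common_neighbor na nb nab nv va vb.
  subst j v; have nab' : a != b by apply: contraNneq nab => ->.
  suff: 3 < #|[set t | upd u i t \in U]| by rewrite line3.
  have <- : #|[set u i; a; b; c]| = 4.
    rewrite -!setUA !cardsU1 cards1 !inE !negb_or.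
    rewrite ![u i == _]eq_sym na nb cu nab'.
    by rewrite ![_ == c]eq_sym ca cb.
  apply: subset_leq_card; apply/subsetP=> t; rewrite !inE.
  by case/orP=> [/orP[/orP[]|]|] /eqP-> //; rewrite upd_id.
by rewrite -vE.
Qed.

(** The corner opposite [x] is absent: the seven others come from the point adjacent to a whole
    shattered triple, the triple itself, and one point per pair. The cyclic order lets one argument
    serve all three pairs. *)
Hypothesis no_cube : forall x i j k a b c,
  i != j -> j != k -> k != i -> a != x i -> b != x j -> c != x k ->
  x \in U -> upd x i a \in U -> upd x j b \in U -> upd x k c \in U ->
  upd (upd x i a) j b \in U -> upd (upd x j b) k c \in U ->
  upd (upd x k c) i a \in U -> False.

Lemma vc_dim_le2 : vc_dim U (nbhs U) <= 2.
Proof.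
apply/bigmax_leqP=> W /andP[/subsetP sWU shW]; rewrite leqNgt.
apply/negP=> /card_gt2P[w1 [w2 [w3 [[W1 W2 W3] [n12 n23 n31]]]]].
have [u uU uE] := shattered_trace shW (subxx W).
(* The third point [z] separates [v] from [u]: only [u] is adjacent to it. *)
have pair x y z : x \in W -> y \in W -> z \in W -> y != z -> z != x ->
    exists v, [/\ v \in U, v != u, hadj v x & hadj v y].
  move=> xW yW zW nyz nzx.
  have sS : [set x; y] \subset W.
    by apply/subsetP=> t; rewrite !inE => /orP[] /eqP->.
  have [v vU vE] := shattered_trace shW sS.
  exists v; split=> //; rewrite ?vE // ?inE ?eqxx ?orbT //.
  apply/eqP=> Ev; have := vE z zW.
  by rewrite Ev uE // zW !inE (negbTE nzx) eq_sym (negbTE nyz).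
have /hadjP[i [a [na E1]]] : hadj u w1 by rewrite uE.
have /hadjP[j [b [nb E2]]] : hadj u w2 by rewrite uE.
have /hadjP[k [c [nc E3]]] : hadj u w3 by rewrite uE.
subst w1 w2 w3.
have [v3 [v3U v3u v31 v32]] := pair _ _ _ W1 W2 W3 n23 n31.
have [v1 [v1U v1u v12 v13]] := pair _ _ _ W2 W3 W1 n31 n12.
have [v2 [v2U v2u v23 v21]] := pair _ _ _ W3 W1 W2 n12 n23.
move/sWU: W1 => W1; move/sWU: W2 => W2; move/sWU: W3 => W3.
have [nij ?] := square_of_common_neighbor uU v3U na nb W1 W2 n12 v3u v31 v32.
have [njk ?] := square_of_common_neighbor uU v1U nb nc W2 W3 n23 v1u v12 v13.
have [nki ?] := square_of_common_neighbor uU v2U nc na W3 W1 n31 v2u v23 v21.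
exact: (no_cube nij njk nki na nb nc).
Qed.

End Hamming.

(** * The case [6 < q]: coordinate sums *)

Lemma sum_upd (d q : nat) (x : hvertex d q) (i : 'I_d) (t : 'Z_q) :
  (\sum_k upd x i t k = \sum_k x k + (t - x i))%R.
Proof.
rewrite (bigD1 i) //= [in RHS](bigD1 i) //= upd_same.
rewrite [RHS]GRing.addrC GRing.addrA GRing.subrK; congr (_ + _)%R.
by apply: eq_bigr => k nk; rewrite upd_other.
Qed.

Lemma natr_Zp_inj (q m n : nat) : 1 < q ->
  m < q -> n < q -> (m%:R = n%:R :> 'Z_q)%R -> m = n.
Proof.
by move=> q_gt1 mq nq /(congr1 val) /=; rewrite !val_Zp_nat // !modn_small.
Qed.

(** Sums of two elements are at most 6 < [q], so the equation already holds in the natural numbers,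
    where each of 0, 1, 2, 3, 4, 6 arises from one unordered pair. *)
Lemma sidon013 (q : nat) (p r s t : 'Z_q) : 6 < q ->
  p \in [:: 0; 1; 3%:R]%R -> r \in [:: 0; 1; 3%:R]%R ->
  s \in [:: 0; 1; 3%:R]%R -> t \in [:: 0; 1; 3%:R]%R ->
  (p + r = s + t)%R -> p != s -> r != s -> False.
Proof.
move=> q6.
have memP (z : 'Z_q) : z \in [:: 0; 1; 3%:R]%R ->
    exists2 n, z = n%:R%R & [|| n == 0, n == 1 | n == 3].
  rewrite !inE => /or3P[] /eqP->; by [exists 0 | exists 1 | exists 3].
move=> /memP[a -> Ha] /memP[b -> Hb] /memP[c -> Hc] /memP[e -> He].
rewrite -!GRing.natrD => E nac nbc.
have abce : a + b = c + e.
  apply: natr_Zp_inj E; first by apply: ltn_trans q6.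
  - apply: leq_ltn_trans q6; by case/or3P: Ha => /eqP->; case/or3P: Hb => /eqP->.
  - apply: leq_ltn_trans q6; by case/or3P: Hc => /eqP->; case/or3P: He => /eqP->.
have {}nac : a != c by apply: contraNneq nac => ->.
have {}nbc : b != c by apply: contraNneq nbc => ->.
move: abce nac nbc.
by case/or3P: Ha => /eqP->; case/or3P: Hb => /eqP->; case/or3P: Hc => /eqP->;
  case/or3P: He => /eqP->.
Qed.

Lemma exists_q_gt6 (d q : nat) : 2 < d -> 6 < q ->
  exists U : {set hvertex d q},
    #|U| = 3 * q ^ (d - 1) /\ vc_dim U (nbhs U) = 2.
Proof.
move=> d_gt2 q_gt6; have q_gt1 : 1 < q by apply: ltn_trans q_gt6.
pose U := [set x : hvertex d q | (\sum_k x k)%R \in [:: 0; 1; 3%:R]%R].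
have line3 (x : hvertex d q) i : #|[set t | upd x i t \in U]| = 3.
  (* Along a line the coordinate sum runs bijectively through ['Z_q]. *)
  have f_inj : injective (fun t : 'Z_q => \sum_k x k + (t - x i))%R.
    by move=> s t /GRing.addrI/GRing.addIr.
  have -> : [set t | upd x i t \in U] =
      (fun t => \sum_k x k + (t - x i))%R @^-1: [set t in [:: 0; 1; 3%:R]%R].
    by apply/setP=> t; rewrite !inE sum_upd.
  rewrite card_preimset // cardsE.
  suff /card_uniqP-> : uniq ([:: 0; 1; 3%:R]%R : seq 'Z_q) by [].
  have natr_neq m n : m < q -> n < q -> m != n -> (m%:R != n%:R :> 'Z_q)%R.
    by move=> mq nq; apply: contraNneq => /natr_Zp_inj->.
  rewrite /= !inE !negb_or !andbT -andbA; apply/and3P.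
  split; [apply: (natr_neq 0 1) | apply: (natr_neq 0 3) | apply: (natr_neq 1 3)];
    by rewrite ?(ltn_trans _ q_gt6).
exists U; split; first exact: card_of_lines.
apply/eqP; rewrite eqn_leq vc_dim_ge2 // andbT; apply: vc_dim_le2 => //.
move=> x i j k a b c nij _ _ na nb _.
(* One square suffices: its two pairs of opposite corners have equal total sums. *)
rewrite !in_set => xU aU bU _ abU _ _; apply: (sidon013 q_gt6 aU bU xU abU).
- rewrite !sum_upd upd_other 1?eq_sym //.
  by rewrite GRing.addrCA.
- by rewrite sum_upd -GRing.subr_eq0 GRing.addrC GRing.addKr GRing.subr_eq0.
- by rewrite sum_upd -GRing.subr_eq0 GRing.addrC GRing.addKr GRing.subr_eq0.
Qed.

(** * The case [q = 6]: a quadratic parity *)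

Definition pair_bit (a b : 'Z_6) : bool := 0 < a./2 <= b./2.

(** [pair_bit] is not symmetric, so each pair of coordinates is taken once, in increasing order. *)
Definition parity (d : nat) (x : hvertex d 6) : bool :=
  \big[addb/false]_i odd (x i) (+)
  \big[addb/false]_(p : 'I_d * 'I_d | p.1 < p.2) pair_bit (x p.1) (x p.2).

(** Exchanges 2z and 2z + 1, and so pairs up the points of a line that share a half. *)
Definition flip (t : 'Z_6) : 'Z_6 := (if odd t then t - 1 else t + 1)%R.

Lemma half_flip t : (flip t)./2 = t./2.
Proof. by case: t => [[|[|[|[|[|[|//]]]]]] ?]. Qed.

Lemma odd_flip t : odd (flip t) = ~~ odd t.
Proof. by case: t => [[|[|[|[|[|[|//]]]]]] ?]. Qed.

Lemma flipK : involutive flip.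
Proof. by case=> [[|[|[|[|[|[|//]]]]]] ?]; apply: val_inj. Qed.

Lemma odd_half_inj (s t : 'Z_6) : odd s = odd t -> s./2 = t./2 -> s = t.
Proof.
move=> Eo Eh; apply: val_inj.
by rewrite /= -(odd_double_half s) Eo Eh odd_double_half.
Qed.

(** Equal halves leave every [pair_bit] unchanged, so only the odd bit at [i] differs. *)
Lemma parity_line (d : nat) (x : hvertex d 6) i (s t : 'Z_6) :
  s != t -> s./2 = t./2 ->
  parity (upd x i s) = ~~ parity (upd x i t).
Proof.
move=> nst Eh; have Eo : odd s = ~~ odd t.
  case Es: (odd s); case Et: (odd t) => //;
    by case/eqP: nst; apply: odd_half_inj; rewrite ?Es ?Et.
rewrite /parity (bigD1 i) //= [in RHS](bigD1 i) //= !upd_same Eo -!addNb.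
congr (_ (+) _ (+) _); first by apply: eq_bigr => k nk; rewrite !upd_other.
apply: eq_bigr => -[k l] /= _; rewrite /pair_bit !ffunE.
by do 2!case: ifP => _ //; rewrite Eh.
Qed.

(** Add the four equal parities: modulo 2, every summand not depending on both changed coordinates
    cancels, and only the pair [(i, j)] survives. *)
Lemma parity_square (d : nat) (x : hvertex d 6) (i j : 'I_d) a b : i < j ->
  parity x = parity (upd x i a) -> parity x = parity (upd x j b) ->
  parity x = parity (upd (upd x i a) j b) ->
  ~~ (pair_bit (x i) (x j) (+) pair_bit a (x j) (+)
      pair_bit (x i) b (+) pair_bit a b).
Proof.
move=> lij Ea Eb Eab.
have nij : i != j by rewrite neq_ltn lij.
have nji : j != i by rewrite eq_sym.
have E0 : parity x (+) parity (upd x i a) (+) parity (upd x j b) (+)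
    parity (upd (upd x i a) j b) = false.
  by rewrite -Ea -Eb -Eab; case: parity.
move: E0; rewrite /parity.
set L0 := \big[_/_]_i odd (x i).
set G0 := \big[_/_]_(p | _) pair_bit (x _) _.
set La := \big[_/_]_k odd (upd x i a k).
set Ga := \big[_/_]_(p | _) pair_bit (upd x i a _) _.
set Lb := \big[_/_]_k odd (upd x j b k).
set Gb := \big[_/_]_(p | _) pair_bit (upd x j b _) _.
set Lab := \big[_/_]_k odd _.
set Gab := \big[_/_]_(p | _) pair_bit _ _.
have -> : (L0 (+) G0) (+) (La (+) Ga) (+) (Lb (+) Gb) (+) (Lab (+) Gab) =
    (L0 (+) La (+) Lb (+) Lab) (+) (G0 (+) Ga (+) Gb (+) Gab).
  by case: L0; case: G0; case: La; case: Ga; case: Lb; case: Gb; case: Lab;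
    case: Gab.
have -> : L0 (+) La (+) Lb (+) Lab = false.
  rewrite /L0 /La /Lb /Lab -!big_split big1 //= => k _; rewrite !ffunE.
  have [->|nkj] := eqVneq k j; last by case: (k == i); case: odd; case: odd.
  by rewrite (negbTE nji); case: odd; case: odd.
rewrite /= /G0 /Ga /Gb /Gab -!big_split /= (bigD1 (i, j)) //= big1; last first.
  move=> [k l] /= /andP[lkl]; rewrite xpair_eqE negb_and !ffunE => nkl.
  (* [cancel1] serves pairs that change with [b] only, [cancel2] those that change with [a] only or
     not at all. *)
  have cancel1 (p r : bool) : p (+) p (+) r (+) r = false by case: p; case: r.
  have cancel2 (p r : bool) : p (+) r (+) p (+) r = false by case: p; case: r.
  have [Elj|nlj] := eqVneq l j.
    move: lkl nkl; rewrite Elj eqxx orbF (negbTE nji) => lkj nki.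
    have nkj : k != j by rewrite neq_ltn lkj.
    by rewrite (negbTE nki) (negbTE nkj) cancel1.
  have [Eli|nli] := eqVneq l i.
    rewrite Eli in lkl.
    have nki : k != i by rewrite neq_ltn lkl.
    have nkj : k != j by rewrite neq_ltn (ltn_trans lkl lij).
    by rewrite (negbTE nki) (negbTE nkj) cancel2.
  have [Ekj|nkj] := eqVneq k j; last by rewrite cancel2.
  by rewrite Ekj (negbTE nji) cancel1.
by rewrite addbF !ffunE !eqxx (negbTE nij) (negbTE nji) => ->.
Qed.

(** In the bilinear picture, v_1 = M v_2 = M v_3 gives v_2 = v_3, and v_2 = M v_3 then makes v_3 a
    nonzero fixed vector of M, which has none. The proof checks all 3^6 choices of halves. *)
Lemma pair_bit_no_cube (z1 z2 z3 a1 a2 a3 : 'Z_6) :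
  a1./2 != z1./2 -> a2./2 != z2./2 -> a3./2 != z3./2 ->
  ~~ (pair_bit z1 z2 (+) pair_bit a1 z2 (+) pair_bit z1 a2 (+) pair_bit a1 a2) ->
  ~~ (pair_bit z2 z3 (+) pair_bit a2 z3 (+) pair_bit z2 a3 (+) pair_bit a2 a3) ->
  ~~ (pair_bit z1 z3 (+) pair_bit a1 z3 (+) pair_bit z1 a3 (+) pair_bit a1 a3) ->
  False.
Proof.
rewrite /pair_bit.
have half3 (t : 'Z_6) : t./2 < 3 by case: t => [[|[|[|[|[|[|//]]]]]] ?].
move: (half3 z1) (half3 z2) (half3 z3) (half3 a1) (half3 a2) (half3 a3).
move: z1./2 z2./2 z3./2 a1./2 a2./2 a3./2.
by move=> [|[|[|//]]] [|[|[|//]]] [|[|[|//]]] [|[|[|//]]] [|[|[|//]]] [|[|[|//]]].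
Qed.

Lemma exists_q_eq6 (d : nat) : 2 < d ->
  exists U : {set hvertex d 6},
    #|U| = 3 * 6 ^ (d - 1) /\ vc_dim U (nbhs U) = 2.
Proof.
move=> d_gt2; pose U := [set x : hvertex d 6 | parity x].
have line3 (x : hvertex d 6) i : #|[set t | upd x i t \in U]| = 3.
  set A := [set t | _].
  (* [flip] exchanges [A] with its complement, so each has half of the six values. *)
  have AC : flip @^-1: A = ~: A.
    apply/setP=> t; rewrite !inE (@parity_line _ x i (flip t) t) ?half_flip //.
    by apply/eqP=> /(congr1 (fun s : 'Z_6 => odd s)); rewrite odd_flip; case: odd.
  have := cardsC A; rewrite -AC card_preimset; last exact: inv_inj flipK.
  by rewrite card_ord addnn => /(congr1 half); rewrite doubleK.
exists U; split; first exact: card_of_lines.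
apply/eqP; rewrite eqn_leq vc_dim_ge2 // andbT; apply: vc_dim_le2 => //.
have half_neq (x : hvertex d 6) i t : t != x i -> x \in U -> upd x i t \in U ->
    t./2 != (x i)./2.
  rewrite !inE => nt xU tU; apply: contraTneq tU => Eh.
  by rewrite (@parity_line _ x i t (x i)) // upd_id xU.
(* [parity] depends on the order of the coordinates, so the directions are first taken in increasing
   order. *)
have sorted_cube (x : hvertex d 6) (i j k : 'I_d) a b c : i < j -> j < k ->
    a != x i -> b != x j -> c != x k ->
    x \in U -> upd x i a \in U -> upd x j b \in U -> upd x k c \in U ->
    upd (upd x i a) j b \in U -> upd (upd x j b) k c \in U ->
    upd (upd x i a) k c \in U -> False.
  move=> ij jk na nb nc xU aU bU cU abU bcU acU.
  have na2 := half_neq _ _ _ na xU aU; have nb2 := half_neq _ _ _ nb xU bU.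
  have nc2 := half_neq _ _ _ nc xU cU.
  move: xU aU bU cU abU bcU acU; rewrite !inE => xU aU bU cU abU bcU acU.
  apply: (@pair_bit_no_cube _ _ _ _ _ _ na2 nb2 nc2); apply: parity_square;
    rewrite ?xU ?aU ?bU ?cU ?abU ?bcU ?acU //; exact: ltn_trans jk.
move=> x i j k a b c nij njk nki na nb nc xU aU bU cU abU bcU caU.
(* Sorting the three directions may reverse the two updates of any square. *)
have baU : upd (upd x j b) i a \in U by rewrite -updC.
have cbU : upd (upd x k c) j b \in U by rewrite -updC.
have acU : upd (upd x i a) k c \in U by rewrite -updC.
case: (ltngtP i j) => [ij|ji|/val_inj/eqP]; last by rewrite (negbTE nij).
  case: (ltngtP j k) => [jk|kj|/val_inj/eqP]; last by rewrite (negbTE njk).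
    exact: (sorted_cube x i j k a b c).
  case: (ltngtP k i) => [ki|ik|/val_inj/eqP]; last by rewrite (negbTE nki).
    exact: (sorted_cube x k i j c a b).
  exact: (sorted_cube x i k j a c b).
case: (ltngtP k i) => [ki|ik|/val_inj/eqP]; last by rewrite (negbTE nki).
  case: (ltngtP j k) => [jk|kj|/val_inj/eqP]; last by rewrite (negbTE njk).
    exact: (sorted_cube x j k i b c a).
  exact: (sorted_cube x k j i c b a).
exact: (sorted_cube x j i k b a c).
Qed.

Theorem lemma4p2 (d q : nat) (hd : 3 <= d) (hq : 6 <= q) :
  exists U : {set hvertex d q},
    #|U| = 3 * q ^ (d - 1) /\ vc_dim U (nbhs U) = 2.
Proof.
move: hq; rewrite leq_eqVlt => /predU1P[<-|q_gt6].
  exact: exists_q_eq6.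
exact: exists_q_gt6.
Qed.
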